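(* Let $(W,S)$ be a Coxeter system with $W$ infinite. Suppose that $A\subset\overline{W}$ and that $A$ admits a join (least upper bound) $w\in\overline{W}$ in the weak order. Let $v\in\overline{W}$ be such that $a\perp v$ for all $a\in A$. Then $w\perp v$.
   Context: $S$ is allowed to be infinite. $\Phi$ is the root system of $(W,S)$ (in the standard reflection representation), $\Phi^+$ and $\Phi^-=-\Phi^+$ the sets of positive and negative roots. For $w\in W$ put $\Phi_w=\{\alpha\in\Phi^+ : w^{-1}(\alpha)\in\Phi^-\}$. An infinite reduced expression is a sequence $s_1s_2s_3\cdots$ with $s_i\in S$ such that $s_1s_2\cdots s_k$ is a reduced expression for every $k\ge 1$; put $\Phi_{s_1s_2s_3\cdots}=\bigcup_{i\ge1}\Phi_{s_1s_2\cdots s_i}$. Two infinite reduced expressions are equivalent if the associated sets $\Phi_{s_1s_2\cdots}$ are equal. $W_l$ is the set of equivalence classes (infinite reduced words), $\Phi_w$ for $w\in W_l$ is the common set attached to the class, and $\overline{W}=W_l\uplus W$ (disjoint union). The weak order on $\overline{W}$ is: $x\le y$ if and only if $\Phi_x\subset\Phi_y$. Elements $x,y\in\overline{W}$ are orthogonal, written $x\perp y$, if $\Phi_x\cap\Phi_y=\emptyset$. *)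

(* Defs.v *)
From HB Require Import structures.
From mathcomp Require Import all_boot all_order all_algebra.
From mathcomp Require Import boolp classical_sets functions cardinality reals.
From mathcomp Require Import trigo.
From mathcomp Require Import freeg.

Set Implicit Arguments.
Unset Strict Implicit.
Unset Printing Implicit Defensive.

Import Order.TTheory GRing.Theory Num.Theory.
Local Open Scope classical_set_scope.
Local Open Scope ring_scope.
Local Open Scope quotient_scope.

Section CoxeterSystem.
Variables (W : groupType) (S : set W).

(* The value 0 encodes an element of infinite order. *)
Definition group_order (x : W) : nat :=
  xget 0%N [set n | [/\ (0 < n)%N, (x ^+ n)%g = 1%g &
    forall k, (0 < k < n)%N -> (x ^+ k)%g <> 1%g]].

Definition cox_m (s t : S) : nat := group_order (val s * val t)%g.

Definition word_prod (u : seq S) : W := (\prod_(s <- u) val s)%g.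

(* The congruence on the free monoid on S generated by (st)^m(s,t) ~ 1 for
   m(s,t) finite.  For s = t this includes ss ~ 1, so that the quotient of the
   free monoid is the group presented by these relations. *)
Inductive cox_congr : seq S -> seq S -> Prop :=
| cox_refl u : cox_congr u u
| cox_sym u v : cox_congr u v -> cox_congr v u
| cox_trans u v w : cox_congr u v -> cox_congr v w -> cox_congr u w
| cox_rel u v s t : (0 < cox_m s t)%N ->
    cox_congr (u ++ flatten (nseq (cox_m s t) [:: s; t]) ++ v) (u ++ v).

(* Since elements of S are involutions, S generates W as a group iff every
   element of W is a product of elements of S. *)
Definition coxeter_system : Prop :=
  [/\ forall s, S s -> group_order s = 2%N,
      forall w : W, exists u : seq S, word_prod u = w
    & forall u v : seq S, word_prod u = word_prod v <-> cox_congr u v].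

Definition reduced_word (u : seq S) : Prop :=
  forall v : seq S, word_prod v = word_prod u -> (size u <= size v)%N.

(* e i stands for s_(i+1), so that mkseq e k is s_1 ... s_k. *)
Definition infinite_reduced (e : nat -> S) : Prop :=
  forall k, (1 <= k)%N -> reduced_word (mkseq e k).

Definition inf_red_expr : Type := {e : nat -> S | `[< infinite_reduced e >]}.
HB.instance Definition _ := Choice.on inf_red_expr.

End CoxeterSystem.

Section RootSystem.
Variables (R : realType) (W : groupType) (S : set W).

Local Notation V := {freeg S / R}.

Definition simple_root (s : S) : V := << s >>.

Definition cox_gram (s t : S) : R :=
  if cox_m s t is 0 then -1 else - cos (pi / (cox_m s t)%:R).

(* x |-> B(x, alpha_t), by linear extension of s |-> B(alpha_s, alpha_t) *)
Definition cox_form (t : S) (x : V) : R :=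
  fglift (fun s => cox_gram s t : R^o) x.

Definition cox_reflection (s : S) (x : V) : V :=
  x - (2 * cox_form s x) *: simple_root s.

(* The standard reflection representation.  In a Coxeter system every w has an
   expression s_1 ... s_k, and as the reflections satisfy the Coxeter relations
   the choice of the expression is irrelevant. *)
Definition cox_act (w : W) (x : V) : V :=
  foldr cox_reflection x (xget [::] [set u : seq S | word_prod u = w]).

Definition cox_roots : set V :=
  [set a | exists (w : W) (s : S), a = cox_act w (simple_root s)].

Definition pos_roots : set V := cox_roots `&` [set a | forall s, 0 <= coeff s a].

Definition neg_roots : set V := [set - a | a in pos_roots].

Definition inv_set (w : W) : set V :=
  [set a | pos_roots a /\ neg_roots (cox_act w^-1%g a)].

Definition inf_inv_set (e : inf_red_expr S) : set V :=
  \bigcup_(i in [set i | (1 <= i)%N]) inv_set (word_prod (mkseq (val e) i)).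

Definition inf_equiv (e f : inf_red_expr S) : bool :=
  `[< inf_inv_set e = inf_inv_set f >].

Lemma inf_equiv_refl : reflexive inf_equiv.
Proof. by move=> e; apply/asboolP. Qed.

Lemma inf_equiv_sym : symmetric inf_equiv.
Proof. by move=> e f; apply/asboolP/asboolP. Qed.

Lemma inf_equiv_trans : transitive inf_equiv.
Proof. by move=> f e g /asboolP ef /asboolP fg; apply/asboolP; rewrite ef. Qed.

Canonical inf_equiv_equiv :=
  EquivRel inf_equiv inf_equiv_refl inf_equiv_sym inf_equiv_trans.

Definition inf_words : Type := {eq_quot inf_equiv}.
HB.instance Definition _ := Choice.on inf_words.
HB.instance Definition _ := EqQuotient.on inf_words.

Definition inf_word_inv_set (x : inf_words) : set V := inf_inv_set (repr x).

Lemma inf_word_inv_set_pi (e : inf_red_expr S) :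
  inf_word_inv_set (\pi_inf_words e) = inf_inv_set e.
Proof.
have /eqmodP/asboolP : repr (\pi_inf_words e) = e %[mod inf_words].
  by rewrite reprK.
exact.
Qed.

Definition Wbar : Type := (inf_words + W)%type.

Definition Phi (x : Wbar) : set V :=
  match x with inl c => inf_word_inv_set c | inr w => inv_set w end.

Definition weak_le (x y : Wbar) : Prop := Phi x `<=` Phi y.

Definition is_join (A : set Wbar) (w : Wbar) : Prop :=
  (forall a, A a -> weak_le a w) /\
  (forall u, (forall a, A a -> weak_le a u) -> weak_le w u).

Definition weak_orth (x y : Wbar) : Prop := Phi x `&` Phi y = set0.

End RootSystem.

(* Main.v *)
(** The inversion sets of elements of [Wbar] are exactly the unions of increasing
    sequences of inversion sets of elements of [W].  Suppose that [Phi w] and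
    [Phi v] share a root; this root lies in [Phi g] for some [g] in [W] with
    [Phi g] contained in [Phi v], so every [a] in [A] is orthogonal to [g].  Write
    [Phi w] as the union of the [Phi (E n)].  Among the elements [x <= E n] of [W]
    orthogonal to [g] there is a greatest one, [M n]: the set of these elements is
    directed.  The increasing sequence [M n] has a limit in [Wbar], which is an
    upper bound of [A] orthogonal to [g]; as [w] lies below it, this is a
    contradiction.

    Directedness is proved by induction from below: if [z] is covered by [z r] and
    [z t], both below [e] and orthogonal to [g], then some [z p] with [p] in the
    dihedral group generated by [r] and [t] lies above both, below [e], and is
    orthogonal to [g].  All this rests on the theorem that
    [len (g s) > len g] implies that [g] maps the simple root of [s] to a
    positive root. *)
Require Import Defs.
From mathcomp Require Import all_boot all_order all_algebra.
From mathcomp Require Import boolp classical_sets functions cardinality reals.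
From mathcomp Require Import trigo freeg ring zify.

Set Implicit Arguments.
Unset Strict Implicit.
Unset Printing Implicit Defensive.

Import Order.TTheory GRing.Theory Num.Theory.
Local Open Scope classical_set_scope.
Local Open Scope ring_scope.

(** * Linear extension from a basis *)

Section FreeLift.
Variables (R : nzRingType) (K : choiceType) (M : lmodType R) (f : K -> M).

Lemma fgliftD (x y : {freeg K / R}) : fglift f (x + y) = fglift f x + fglift f y.
Proof.
(* [lift_is_additive] concerns differences: the pairs [(0, 0)] and [(0, y)] give the values at [0]
   and [- y], and then [x + y] is [x - (- y)]. *)
have /(_ x (- y)) := lift_is_additive f.
have /(_ 0 y) := lift_is_additive f.
have /(_ 0 0) := lift_is_additive f.
by rewrite subrr subrr opprK => -> ; rewrite !sub0r => ->; rewrite opprK.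
Qed.

Lemma fgliftE (x : {freeg K / R}) : fglift f x = \sum_(z <- dom x) coeff z x *: f z.
Proof.
have f0 : fglift f 0 = 0 :> M.
  by rewrite -(subrr (0 : {freeg K / R})) lift_is_additive subrr.
rewrite -[in LHS](freeg_sumE x) (big_morph (fglift f) fgliftD f0).
by apply: eq_bigr => z _; rewrite liftU.
Qed.

Lemma fgliftZ c (x : {freeg K / R}) : fglift f (c *: x) = c *: fglift f x.
Proof.
have f0 : fglift f 0 = 0 :> M.
  by rewrite -(subrr (0 : {freeg K / R})) lift_is_additive subrr.
rewrite (fgliftE x) (big_morph (fglift f) fgliftD f0) scaler_sumr.
by apply: eq_bigr => z _; rewrite liftU scalerA.
Qed.

End FreeLift.

(** * Chebyshev polynomials at the cosines of the Coxeter form *)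

Section Chebyshev.
Variable R : realType.

(* [cheb c n] is U_(n-1)(c), U the Chebyshev polynomials of the second kind: the
   roots of a rank two subsystem have coefficients sin (n x) / sin x. *)
Fixpoint cheb (c : R) (n : nat) : R :=
  if n is n'.+1 then
    if n' is n''.+1 then 2 * c * cheb c n' - cheb c n'' else 1
  else 0.

Lemma chebSS c n : cheb c n.+2 = 2 * c * cheb c n.+1 - cheb c n.
Proof. by []. Qed.

(** Serves the pairs of infinite order, where [cox_gram] is -1. *)
Lemma cheb1 n : cheb 1 n = n%:R.
Proof.
suff : cheb 1 n = n%:R /\ cheb 1 n.+1 = n.+1%:R by case.
elim: n => [|n [IH1 IH2]]; first by [].
by split => //; rewrite chebSS IH1 IH2 -!natr1; ring.
Qed.

Lemma cheb_cos (x : R) n : cheb (cos x) n * sin x = sin (n%:R * x).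
Proof.
suff : cheb (cos x) n * sin x = sin (n%:R * x) /\
       cheb (cos x) n.+1 * sin x = sin (n.+1%:R * x) by case.
elim: n => [|n [IH1 IH2]]; first by rewrite mul0r !mul1r mul0r sin0.
split => //; rewrite chebSS mulrBl IH1 -(mulrA (2 * cos x)) IH2.
have -> : n.+2%:R * x = n.+1%:R * x + x by rewrite -natr1; ring.
have -> : n%:R * x = n.+1%:R * x - x by rewrite -natr1; ring.
by rewrite !sinD cosN sinN; ring.
Qed.

Lemma sin_pi_div_gt0 m : (1 < m)%N -> 0 < sin (pi / m%:R : R).
Proof.
move=> m1; have m0 : 0 < m%:R :> R by rewrite ltr0n; lia.
apply: sin_gt0_pi; rewrite divr_gt0 ?pi_gt0 //= ltr_pdivrMr //.
by rewrite ltr_pMr ?pi_gt0 // ltr1n.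
Qed.

Lemma cheb_cos_pi_ge0 m n : (n <= m)%N -> 0 <= cheb (cos (pi / m%:R)) n :> R.
Proof.
case: (ltnP 1 m) => [m1 nm|]; last first.
  (* For [m <= 1] the sine of [pi / m] vanishes and cannot be cancelled, but then [n <= 1] and the
     value is 0 or 1. *)
  by case: m => [|[|m]] // _; case: n => [|[|n]].
rewrite -(pmulr_lge0 _ (sin_pi_div_gt0 m1)) cheb_cos.
have m0 : 0 < m%:R :> R by rewrite ltr0n; lia.
have p0 : 0 <= pi / m%:R :> R by rewrite divr_ge0 ?pi_ge0 // ltW.
apply: sin_ge0_pi; rewrite mulr_ge0 ?ler0n //= mulrA ler_pdivrMr //.
by rewrite mulrC ler_wpM2l ?pi_ge0 // ler_nat.
Qed.

(** The angle [2 m (pi / m)] is a full turn. These are the coefficients that occur when [(s t)^m]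
    acts on the plane of two simple roots. *)
Lemma cheb_cos_pi_period m : (1 < m)%N ->
  [/\ cheb (cos (pi / m%:R : R)) m.*2 = 0,
      cheb (cos (pi / m%:R : R)) m.*2.+1 = 1 &
      cheb (cos (pi / m%:R : R)) m.*2.-1 = -1].
Proof.
move=> m1; have s0 := sin_pi_div_gt0 m1.
have m0 : m%:R != 0 :> R by rewrite pnatr_eq0; lia.
have dbl : (m.*2)%:R * (pi / m%:R) = pi *+ 2 :> R.
  by rewrite -muln2 natrM mulr_natr; field.
have s0' := lt0r_neq0 s0.
split; apply: (mulIf s0'); rewrite cheb_cos.
- by rewrite dbl sin2pi mul0r.
- by rewrite -natr1 mulrDl dbl mul1r addrC sinD2pi mul1r.
have -> : (m.*2.-1)%:R * (pi / m%:R) = - (pi / m%:R) + pi *+ 2 :> R.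
  rewrite -dbl; have -> : (m.*2)%:R = (m.*2.-1)%:R + 1 :> R.
    by rewrite natr1 prednK // double_gt0; lia.
  by ring.
by rewrite sinD2pi sinN mulN1r.
Qed.

End Chebyshev.

(** * Alternating words in two letters *)

Section AlternatingWords.
Variable T : Type.

Fixpoint altw (a b : T) (n : nat) : seq T :=
  if n is n'.+1 then a :: altw b a n' else [::].

Lemma size_altw a b n : size (altw a b n) = n.
Proof. by elim: n a b => //= n IH a b; rewrite IH. Qed.

Lemma altw_cat a b n k :
  altw a b (n + k) = altw a b n ++ (if odd n then altw b a k else altw a b k).
Proof.
elim: n a b => //= n IH a b; rewrite IH; by case: (odd n).
Qed.

Lemma rev_altw a b n : rev (altw a b n) = if odd n then altw a b n else altw b a n.
Proof.
elim: n a b => // n IH a b; rewrite -[n.+1 in RHS]addn1 !altw_cat /= rev_cons IH.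
by rewrite addn1 /=; case: (odd n); rewrite /= cats1.
Qed.

Lemma altw_double a b n : altw a b n.*2 = flatten (nseq n [:: a; b]).
Proof. by elim: n => //= n ->. Qed.

End AlternatingWords.

(** * The reflections satisfy the Coxeter relations *)

Section ReflectionRepresentation.
Variables (R : realType) (W : groupType) (S : set W).
Local Notation V := {freeg S / R}.
Local Notation al := (@simple_root R W S).
Local Notation form := (@cox_form R W S).
Local Notation refl := (@cox_reflection R W S).
Local Notation gram := (@cox_gram R W S).
Implicit Types (s t : S) (x y : V) (u : seq S).

Lemma freeg_ext x y : (forall s, coeff s x = coeff s y) -> x = y.
Proof. by move=> h; apply/eqP/freeg_eqP. Qed.

Lemma coeff_simple s t : coeff t (al s) = (s == t)%:R.
Proof. by rewrite coeffU mul1r. Qed.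

Lemma cox_formD t x y : form t (x + y) = form t x + form t y.
Proof. exact: (fgliftD (fun s : S => gram s t : R^o)). Qed.

Lemma cox_formZ t c x : form t (c *: x) = c * form t x.
Proof. exact: (fgliftZ (fun s : S => gram s t : R^o)). Qed.

Lemma cox_formB t x y : form t (x - y) = form t x - form t y.
Proof. by rewrite cox_formD -scaleN1r cox_formZ mulN1r. Qed.

Lemma cox_form_simple t s : form t (al s) = gram s t.
Proof. by rewrite /cox_form liftU scale1r. Qed.

Lemma cox_reflectionD s x y : refl s (x + y) = refl s x + refl s y.
Proof.
by rewrite /cox_reflection cox_formD mulrDr scalerDl opprD addrACA.
Qed.

Lemma cox_reflectionZ s c x : refl s (c *: x) = c *: refl s x.
Proof.
by rewrite /cox_reflection cox_formZ scalerBr scalerA; congr (_ - _ *: _); ring.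
Qed.

Definition word_act u x : V := foldr (@cox_reflection R W S) x u.

Lemma word_act_cat u v x : word_act (u ++ v) x = word_act u (word_act v x).
Proof. exact: foldr_cat. Qed.

Lemma word_actD u x y : word_act u (x + y) = word_act u x + word_act u y.
Proof. by elim: u => //= s u ->; rewrite cox_reflectionD. Qed.

Lemma word_actZ u c x : word_act u (c *: x) = c *: word_act u x.
Proof. by elim: u => //= s u ->; rewrite cox_reflectionZ. Qed.

Lemma group_orderP (g : W) : (0 < group_order g)%N -> (g ^+ group_order g)%g = 1%g.
Proof. by rewrite /group_order; case: xgetP => // n _ []. Qed.

(** Needed for the symmetry of [cox_m], as [t s] is the inverse of [s t]. *)
Lemma group_orderV (g : W) : group_order g^-1%g = group_order g.
Proof.
rewrite /group_order; congr xget; apply/seteqP; split=> n /= [n0 h1 h2]; split=> //.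
- by apply: invg_inj; rewrite -expVgn h1 invg1.
- by move=> k /h2 h /(congr1 monoid.inv); rewrite invg1 -expVgn.
- by rewrite expVgn h1 invg1.
- by move=> k /h2 h; rewrite expVgn => /(congr1 monoid.inv); rewrite invgK invg1.
Qed.

Hypothesis invol : forall s, (val s * val s = 1)%g.

Lemma val_invg s : ((val s)^-1 = val s)%g.
Proof. by rewrite -[LHS]mulg1 -(invol s) mulKg. Qed.

Lemma cox_mC s t : cox_m s t = cox_m t s.
Proof. by rewrite /cox_m -group_orderV invgM !val_invg. Qed.

Lemma cox_mss s : cox_m s s = 1%N.
Proof.
rewrite /cox_m invol /group_order; case: xgetP => [n _ [n0 _ h]|h].
  by case: n n0 h => [|[|n]] // _ /(_ 1%N erefl); rewrite expg1.
by case: (h 1%N); split => // k; lia.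
Qed.

Lemma cox_m_gt1 s t : s != t -> (0 < cox_m s t)%N -> (1 < cox_m s t)%N.
Proof.
move=> st m0; rewrite ltn_neqAle m0 andbT; apply/eqP => m1.
move: (group_orderP m0); rewrite -/(cox_m s t) -m1 expg1 => h.
by move/eqP: st; apply; apply: val_inj; rewrite -[RHS]mul1g -h -mulgA invol mulg1.
Qed.

Lemma cox_gramC s t : gram s t = gram t s.
Proof. by rewrite /cox_gram cox_mC. Qed.

Lemma cox_gramss s : gram s s = 1.
Proof. by rewrite /cox_gram cox_mss divr1 cospi opprK. Qed.

Lemma cox_reflection_simple s : refl s (al s) = - al s.
Proof.
rewrite /cox_reflection cox_form_simple cox_gramss mulr1.
by rewrite -{1}[al s]scale1r -scalerBl -scaleN1r; congr (_ *: _); ring.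
Qed.

Lemma cox_reflection_simple_neq s t :
  refl s (al t) = al t - (2 * gram t s) *: al s.
Proof. by rewrite /cox_reflection cox_form_simple. Qed.

Lemma cox_reflectionK s : involutive (refl s).
Proof.
move=> x; rewrite {2}/cox_reflection cox_reflectionD -scalerN cox_reflectionZ.
by rewrite -scaleN1r cox_reflectionZ cox_reflection_simple scaleN1r opprK subrK.
Qed.

(** The simple root belongs to the letter that would continue the word. A further letter in front
    exchanges [s] and [t], and its reflection acts on the two coefficients by the Chebyshev
    recurrence. *)
Lemma word_act_alt s t n :
  word_act (altw s t n) (al (if odd n then t else s)) =
  cheb (- gram s t) n.+1 *: al s + cheb (- gram s t) n *: al t.
Proof.
elim: n s t => [|n IH] s t; first by rewrite /= scale0r addr0 scale1r.
rewrite [altw _ _ _]/= [word_act _ _]/= -/(word_act _ _).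
have -> : (if odd n.+1 then t else s) = (if odd n then s else t).
  by rewrite /=; case: (odd n).
rewrite IH cox_reflectionD !cox_reflectionZ cox_reflection_simple.
rewrite cox_reflection_simple_neq chebSS (cox_gramC t s).
by apply: freeg_ext => z; rewrite !(coeffD, coeffN, coeffZ); ring.
Qed.

Lemma word_act_fix u x : (forall s, s \in u -> form s x = 0) -> word_act u x = x.
Proof.
elim: u => //= s u IH h; rewrite -/(word_act u x) IH; last first.
  by move=> t tu; apply: h; rewrite inE tu orbT.
by rewrite /cox_reflection h ?mem_head // mulr0 scale0r subr0.
Qed.

Lemma gramE s t : (0 < cox_m s t)%N -> - gram s t = cos (pi / (cox_m s t)%:R).
Proof. by rewrite /cox_gram; case: cox_m => // n _; rewrite opprK. Qed.

Lemma cheb_gram_ge0 s t n : ((0 < cox_m s t)%N -> (n <= cox_m s t)%N) ->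
  0 <= cheb (- gram s t) n.
Proof.
case: (posnP (cox_m s t)) => [m0 _|m0 /(_ isT) nm].
  by rewrite /cox_gram m0 opprK cheb1 ler0n.
by rewrite gramE // cheb_cos_pi_ge0.
Qed.

(** For [s != t] the relator fixes both simple roots by periodicity, and every vector orthogonal to
    them. The form is nondegenerate on their plane, its Gram determinant being a squared nonzero
    sine, so these vectors span the space. *)
Lemma word_act_relation s t x : (0 < cox_m s t)%N ->
  word_act (flatten (nseq (cox_m s t) [:: s; t])) x = x.
Proof.
case: (eqVneq s t) => [<- _|st m0].
  by elim: (cox_m s s) => //= n IH; rewrite -/(word_act _ _) IH cox_reflectionK.
have m1 := cox_m_gt1 st m0.
have [c0 c1 c2] := cheb_cos_pi_period R m1.
have sin0 := sin_pi_div_gt0 R m1.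
have cs := cos2Dsin2 (pi / (cox_m s t)%:R : R).
rewrite -gramE // in c0 c1 c2 cs.
set m := cox_m s t in m0 m1 c0 c1 c2 sin0 cs *.
rewrite -altw_double; set w := altw _ _ _.
have ws : word_act w (al s) = al s.
  by have := word_act_alt s t m.*2; rewrite odd_double c0 c1 scale1r scale0r addr0.
have wt : word_act w (al t) = al t.
  (* The last letter [t] negates [al t], and the remaining word of odd length [2 m - 1] negates it
     again. *)
  have [k mk] : exists k, m.*2 = k.+1 by exists m.*2.-1; lia.
  have ok : odd k by have := odd_double m; rewrite mk /= => /negbFE.
  rewrite /w mk -addn1 altw_cat ok word_act_cat /= cox_reflection_simple -scaleN1r word_actZ.
  have := word_act_alt s t k; rewrite ok -mk c0 scale0r add0r => ->.
  by move: c2; rewrite mk /= => ->; rewrite scalerA mulrNN mulr1 scale1r.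
set g := gram s t in cs *; set d := sin _ in cs sin0.
have d0 : 1 - g ^+ 2 != 0.
  have -> : 1 - g ^+ 2 = d ^+ 2 by rewrite -cs; ring.
  by rewrite expf_eq0 /= lt0r_neq0.
(* [a] and [b] solve the linear system that makes [y] orthogonal to both simple roots. *)
pose p := form s x; pose q := form t x.
pose a := (p - g * q) / (1 - g ^+ 2); pose b := (q - g * p) / (1 - g ^+ 2).
pose y := x - (a *: al s + b *: al t).
have ys : form s y = 0.
  rewrite cox_formB cox_formD !cox_formZ !cox_form_simple cox_gramss.
  by rewrite (cox_gramC t s) -/g -/p /a /b; field.
have yt : form t y = 0.
  rewrite cox_formB cox_formD !cox_formZ !cox_form_simple cox_gramss.
  by rewrite -/g -/q /a /b; field.
have -> : x = y + (a *: al s + b *: al t) by rewrite subrK.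
clearbody y.
rewrite !word_actD !word_actZ ws wt word_act_fix // => z.
rewrite /w altw_double => /flattenP [v /nseqP [-> _]].
by rewrite !inE => /orP [] /eqP ->.
Qed.

Lemma cox_congr_act u v x : cox_congr u v -> word_act u x = word_act v x.
Proof.
move=> uv; elim: uv x => [//|u1 v1 _ IH x|u1 v1 w1 _ IH1 _ IH2 x|u1 v1 s t m0 x].
- by rewrite IH.
- by rewrite IH1 IH2.
by rewrite !word_act_cat word_act_relation.
Qed.

Lemma cox_congr_odd u v : cox_congr u v -> odd (size u) = odd (size v).
Proof.
elim => [//|//|u1 v1 w1 _ -> //|u1 v1 s t _].
by rewrite !size_cat -altw_double size_altw !oddD odd_double.
Qed.

End ReflectionRepresentation.

(** * The length function *)

Section Length.
Variables (W : groupType) (S : set W).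
Hypothesis HWS : coxeter_system S.
Implicit Types (s t : S) (u : seq S) (g h : W).
Local Notation wp := (@word_prod W S).

Lemma coxeter_invol s : (val s * val s = 1)%g.
Proof.
case: HWS => h _ _; have := h (val s) (set_valP s) => o2.
by have := @group_orderP W (val s); rewrite o2 => /(_ isT).
Qed.

Lemma word_prod_cat u v : wp (u ++ v) = (wp u * wp v)%g.
Proof. exact: big_cat. Qed.

Lemma word_prod_cons s u : wp (s :: u) = (val s * wp u)%g.
Proof. exact: big_cons. Qed.

Lemma word_prod_nil : wp [::] = 1%g.
Proof. exact: big_nil. Qed.

Lemma word_prod1 s : wp [:: s] = val s.
Proof. exact: big_seq1. Qed.

Lemma word_prod_rev u : wp (rev u) = (wp u)^-1%g.
Proof.
elim: u => [|s u IH]; first by rewrite word_prod_nil invg1.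
rewrite rev_cons -cats1 word_prod_cat IH word_prod1 word_prod_cons invgM.
by rewrite val_invg //; exact: coxeter_invol.
Qed.

Definition red_word g : seq S := xget [::] [set u | wp u = g /\ reduced_word u].
Definition len g : nat := size (red_word g).

Lemma red_wordP g : wp (red_word g) = g /\ reduced_word (red_word g).
Proof.
rewrite /red_word; case: xgetP => // none; exfalso.
have [u0 u0g] : exists u, wp u = g by case: HWS.
have ex : exists n, `[< exists u, size u = n /\ wp u = g >].
  by exists (size u0); apply/asboolP; exists u0.
case: (ex_minnP ex) => n /asboolP [u [un ug]] nmin.
apply: (none u); split => // v; rewrite ug un => vg.
by apply: nmin; apply/asboolP; exists v.
Qed.

Lemma red_wordK g : wp (red_word g) = g.
Proof. by case: (red_wordP g). Qed.

Lemma len_word u : (len (wp u) <= size u)%N.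
Proof. by have [wg red] := red_wordP (wp u); apply: red. Qed.

Lemma reduced_wordE u : reduced_word u <-> len (wp u) = size u.
Proof.
split => [red|h v vu].
  by apply/eqP; rewrite eqn_leq len_word red // red_wordK.
by rewrite -h -vu len_word.
Qed.

Lemma len1 : len 1%g = 0%N.
Proof. by apply/eqP; rewrite -leqn0; have := len_word [::]; rewrite word_prod_nil. Qed.

Lemma len_eq0 g : len g = 0%N -> g = 1%g.
Proof. by move/size0nil => h; rewrite -(red_wordK g) h word_prod_nil. Qed.

Lemma lenM g h : (len (g * h)%g <= len g + len h)%N.
Proof.
by rewrite -{1}(red_wordK g) -{1}(red_wordK h) -word_prod_cat -size_cat len_word.
Qed.

Lemma lenV g : len (g^-1)%g = len g.
Proof.
suff le k : (len (k^-1)%g <= len k)%N.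
  by apply/eqP; rewrite eqn_leq le -{1}(invgK g) le.
by rewrite -{1}(red_wordK k) -word_prod_rev (leq_trans (len_word _)) // size_rev.
Qed.

Lemma len_odd u : odd (len (wp u)) = odd (size u).
Proof.
case: HWS => _ _ /(_ (red_word (wp u)) u) [h _].
exact: (cox_congr_odd (h (red_wordK _))).
Qed.

(** A generator changes the length by at most one, and parity excludes no change. *)
Lemma len_mul_simple g s :
  len (g * val s)%g = (len g).+1 \/ len g = (len (g * val s)%g).+1.
Proof.
have one k : (len (k * val s)%g <= (len k).+1)%N.
  by rewrite (leq_trans (lenM _ _)) // -addn1 leq_add2l -(word_prod1 s) len_word.
have h1 := one g; have := one (g * val s)%g.
rewrite -mulgA coxeter_invol mulg1 => h2.
have := len_odd (rcons (red_word g) s).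
rewrite -cats1 word_prod_cat red_wordK word_prod1 size_cat addn1 oddS -/(len g).
move=> h3; case: (ltngtP (len (g * val s)%g) (len g)) => h4; [right|left|].
- by lia.
- by lia.
by rewrite h4 in h3; move: h3; case: (odd _).
Qed.

Lemma last_letter g : g <> 1%g -> exists s, len g = (len (g * val s)%g).+1.
Proof.
move=> g1; have := red_wordK g; have : len g = size (red_word g) by [].
case/lastP: (red_word g) => [|u s lg ug].
  by move=> _; rewrite word_prod_nil => /esym.
exists s; case: (len_mul_simple g s) => // h; exfalso.
move: h; rewrite lg size_rcons -ug -cats1 word_prod_cat word_prod1 -mulgA.
rewrite coxeter_invol mulg1 => h; have := len_word u. lia.
Qed.

Lemma first_letter g : g <> 1%g -> exists s, len g = (len (val s * g)%g).+1.
Proof.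
move=> g1; have [|s] := @last_letter g^-1%g.
  by move=> /(congr1 monoid.inv); rewrite invgK invg1.
rewrite lenV => ->; exists s; rewrite -[in RHS]lenV invgM val_invg //.
exact: coxeter_invol.
Qed.

Lemma mulg_simpleK g s : (g * val s * val s)%g = g.
Proof. by rewrite -mulgA coxeter_invol mulg1. Qed.

Lemma mul_simpleKg g s : (val s * (val s * g))%g = g.
Proof. by rewrite mulgA coxeter_invol mul1g. Qed.

(** The braid relation: the left word followed by the reverse of the right one is the relator
    [(s t)^m]. *)
Lemma word_prod_altw_cox_m s t : (0 < cox_m s t)%N ->
  wp (altw s t (cox_m s t)) = wp (altw t s (cox_m s t)).
Proof.
set m := cox_m s t => m0; apply: (mulIg (wp (altw t s m))^-1%g); rewrite mulgV.
rewrite -word_prod_rev rev_altw -word_prod_cat.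
rewrite -altw_cat addnn altw_double.
have -> : wp (flatten (nseq m [:: s; t])) = ((val s * val t) ^+ m)%g.
  elim: m {m0} => [|n IH]; first by rewrite word_prod_nil.
  by rewrite expgS /= !word_prod_cons IH mulgA.
exact: group_orderP.
Qed.

End Length.

(** * Signs of roots and inversion sets *)

Section Roots.
Variables (R : realType) (W : groupType) (S : set W).
Hypothesis HWS : coxeter_system S.
Local Notation V := {freeg S / R}.
Local Notation al := (@simple_root R W S).
Local Notation wp := (@word_prod W S).
Local Notation len := (@len W S).
Local Notation act := (@cox_act R W S).
Implicit Types (s t : S) (x y : V) (u : seq S) (g h : W).
Let invol := coxeter_invol HWS.

(** The word chosen in [cox_act] is congruent to [u], and congruent words act alike. *)
Lemma cox_act_word u x : act (wp u) x = word_act u x.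
Proof.
rewrite /cox_act; set v := xget _ _.
have vu : wp v = wp u by apply: (@xgetPex _ [::] [set v | wp v = wp u]); exists u.
by case: HWS => _ _ /(_ v u) [/(_ vu) vu' _]; exact: (cox_congr_act invol x vu').
Qed.

Lemma cox_actM g h x : act (g * h)%g x = act g (act h x).
Proof.
rewrite -(red_wordK HWS g) -(red_wordK HWS h) -word_prod_cat.
by rewrite !cox_act_word word_act_cat.
Qed.

Lemma cox_act1 x : act 1%g x = x.
Proof. by rewrite -(word_prod_nil S) cox_act_word. Qed.

Lemma cox_actK g : cancel (act g) (act g^-1%g).
Proof. by move=> x; rewrite -cox_actM mulVg cox_act1. Qed.

Lemma cox_actKV g : cancel (act g^-1%g) (act g).
Proof. by move=> x; rewrite -cox_actM mulgV cox_act1. Qed.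

Lemma cox_actD g x y : act g (x + y) = act g x + act g y.
Proof. by rewrite -(red_wordK HWS g) !cox_act_word word_actD. Qed.

Lemma cox_actZ g c x : act g (c *: x) = c *: act g x.
Proof. by rewrite -(red_wordK HWS g) !cox_act_word word_actZ. Qed.

Lemma cox_actN g x : act g (- x) = - act g x.
Proof. by rewrite -scaleN1r cox_actZ scaleN1r. Qed.

Lemma cox_act_simple s x : act (val s) x = cox_reflection s x.
Proof. by rewrite -word_prod1 cox_act_word. Qed.

Definition nonneg x := forall s, 0 <= coeff s x.

Lemma nonneg_simple s : nonneg (al s).
Proof. by move=> t; rewrite coeff_simple ler0n. Qed.

Lemma nonneg_comb a b x y : 0 <= a -> 0 <= b -> nonneg x -> nonneg y ->
  nonneg (a *: x + b *: y).
Proof.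
by move=> a0 b0 x0 y0 s; rewrite coeffD !coeffZ addr_ge0 ?mulr_ge0.
Qed.

(* Let [k] be the length of the longest reduced suffix of [g] that alternates [s] and
   [t] and ends in [t], and [v] the remaining prefix: by induction [v] maps both
   simple roots to positive ones, and [k < cox_m t s], so that the suffix maps the
   simple root of [s] to a nonnegative combination of them. *)
Lemma nonneg_act_simple g s : len (g * val s)%g = (len g).+1 -> nonneg (act g (al s)).
Proof.
have [n] := ubnP (len g); elim: n g s => // n IH g s gn gs.
case: (pselect (g = 1%g)) => [->|g1]; first by rewrite cox_act1; exact: nonneg_simple.
have [t gt] := last_letter HWS g1.
pose P k := (len (g * wp (altw t s k))%g + k == len g)%N.
have P1 : P 1%N by rewrite /P /= word_prod1 gt addn1.
have Pb k : P k -> (k <= len g)%N by move=> /eqP <-; exact: leq_addl.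
case: (ex_maxnP (ex_intro P 1%N P1) Pb) => k /eqP Pk kmax.
have k0 : (0 < k)%N by apply: kmax.
set v := (g * wp (altw t s k))%g in Pk.
have gv : g = (v * wp (rev (altw t s k)))%g.
  by rewrite word_prod_rev // mulgK.
(* [a] is the last letter of [altw t s k], and [b] the letter that would continue it. *)
pose b := if odd k then s else t; pose a := if odd k then t else s.
have vb : nonneg (act v (al b)).
  apply: IH; first by lia.
  case: (len_mul_simple HWS v b) => // vb; exfalso.
  suff /kmax : P k.+1 by rewrite ltnn.
  rewrite /P -[k.+1]addn1 altw_cat word_prod_cat mulgA -/v.
  have -> : (if odd k then altw s t 1 else altw t s 1) = [:: b].
    by rewrite /b; case: (odd k).
  by rewrite word_prod1 addn1 addnS -addSn -vb Pk.
have va : nonneg (act v (al a)).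
  apply: IH; first by lia.
  case: (len_mul_simple HWS v a) => // va; exfalso.
  (* If [a] shortened [v], then [g] would be a product of [v a], of length [len v - 1], and a word
     of length [k - 1]: too short. *)
  have [j kj] : exists j, k = j.+1 by exists k.-1; lia.
  have vE : (v * val a = g * wp (altw t s j))%g.
    rewrite /v kj -addn1 altw_cat word_prod_cat mulgA.
    have -> : (if odd j then altw s t 1 else altw t s 1) = [:: a].
      by rewrite /a kj /=; case: (odd j).
    by rewrite word_prod1 -(mulgA (g * _)%g) invol mulg1.
  have : (len g <= len (v * val a)%g + j)%N.
    rewrite vE -[X in (len X <= _)%N](mulgK (wp (altw t s j)) g).
    rewrite (leq_trans (lenM HWS _ _)) // leq_add2l (lenV HWS).
    by rewrite (leq_trans (len_word HWS _)) // size_altw.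
  by rewrite -Pk va kj addSnnS; move: (len (v * _)%g) => ?; clear; lia.
have km : (0 < cox_m t s)%N -> (k < cox_m t s)%N.
  (* If [m <= k], the braid relation makes the alternating word begin with [s], so that
     [len (g s) <= len v + k - 1 < len g]. *)
  move=> m0; rewrite ltnNge; apply/negP => mk.
  set m := cox_m t s in m0 mk.
  pose X := behead (altw s t m) ++ (if odd m then altw s t (k - m) else altw t s (k - m)).
  have vE : (v = g * val s * wp X)%g.
    rewrite /v -{1}(subnKC mk) altw_cat word_prod_cat word_prod_altw_cox_m // -/m.
    rewrite /X; case: m m0 {mk X} => // m _ /=.
    by rewrite word_prod_cons word_prod_cat !mulgA.
  have sX : size X = k.-1.
    rewrite size_cat size_behead size_altw; case: (odd m); rewrite size_altw. lia. lia.
  have : (len (g * val s)%g <= len v + k.-1)%N.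
    rewrite -[X in (len X <= _)%N](mulgK (wp X)) -vE.
    rewrite (leq_trans (lenM HWS _ _)) // leq_add2l (lenV HWS).
    by rewrite (leq_trans (len_word HWS _)) // sX.
  by lia.
rewrite gv cox_actM cox_act_word rev_altw.
have ab : (if odd k then altw t s k else altw s t k) = altw a b k.
  by rewrite /a /b; case: (odd k).
have sE : s = (if odd k then b else a) by rewrite /a /b; case: (odd k).
rewrite ab {1}sE word_act_alt // cox_actD !cox_actZ.
have km' : (0 < cox_m a b)%N -> (k < cox_m a b)%N.
  by rewrite /a /b; case: (odd k); rewrite ?(cox_mC invol s t).
by apply: nonneg_comb => //; apply: cheb_gram_ge0 => // /km' // /ltnW.
Qed.

(** The full Coxeter form B, of which [cox_form] is the case of a simple second argument. *)
Definition cox_bilin x y : R := fglift (fun t => cox_form t x : R^o) y.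

Lemma cox_bilinDZr x y c s : cox_bilin x (y + c *: al s) = cox_bilin x y + c * cox_form s x.
Proof.
by rewrite /cox_bilin fgliftD fgliftZ liftU scale1r.
Qed.

Lemma cox_bilinDZl x y c s : cox_bilin (x + c *: al s) y = cox_bilin x y + c * cox_form s y.
Proof.
have -> : cox_form s y = \sum_(z <- dom y) coeff z y * cox_gram R z s.
  by rewrite /cox_form fgliftE.
rewrite /cox_bilin !fgliftE mulr_sumr -big_split; apply: eq_bigr => z _ /=.
rewrite cox_formD cox_formZ cox_form_simple (cox_gramC R invol s z).
by rewrite /GRing.scale /=; ring.
Qed.

Lemma cox_bilin_reflection s x y :
  cox_bilin (cox_reflection s x) (cox_reflection s y) = cox_bilin x y.
Proof.
rewrite /cox_reflection -!scaleNr cox_bilinDZr cox_bilinDZl.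
by rewrite cox_formD cox_formZ cox_form_simple cox_gramss //; ring.
Qed.

Lemma cox_bilin_act g x y : cox_bilin (act g x) (act g y) = cox_bilin x y.
Proof.
rewrite -(red_wordK HWS g) !cox_act_word.
by elim: (red_word _ g) => //= s u IH; rewrite cox_bilin_reflection.
Qed.

Lemma cox_bilin_simple s : cox_bilin (al s) (al s) = 1.
Proof.
have := cox_bilinDZr (al s) 0 1 s; rewrite add0r scale1r => ->.
rewrite cox_form_simple cox_gramss // mul1r /cox_bilin.
by rewrite -{1}(scale0r (0 : V)) fgliftZ scale0r add0r.
Qed.

(* Roots have norm 1 for the invariant form. *)
Lemma root_scale_simple g s t c : 0 <= c -> act g (al t) = c *: al s -> c = 1.
Proof.
move=> c0 h; have := cox_bilin_act g (al t) (al t); rewrite h cox_bilin_simple.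
have -> : cox_bilin (c *: al s) (c *: al s) = c ^+ 2.
  have := cox_bilinDZr (c *: al s) 0 c s; rewrite add0r => ->.
  rewrite cox_formZ cox_form_simple cox_gramss // mulr1 /cox_bilin.
  by rewrite -{1}(scale0r (0 : V)) fgliftZ scale0r add0r.
by move=> cc; apply/eqP; rewrite -(@eqrXn2 _ 2) // cc expr1n.
Qed.

Implicit Types a b : V.

Lemma root_act g a : cox_roots a -> cox_roots (act g a).
Proof. by move=> [w [s ->]]; exists (g * w)%g, s; rewrite cox_actM. Qed.

Lemma root_simple s : cox_roots (al s).
Proof. by exists 1%g, s; rewrite cox_act1. Qed.

Lemma root_opp a : cox_roots a -> cox_roots (- a).
Proof.
move=> [w [s ->]]; exists (w * val s)%g, s.
by rewrite cox_actM cox_act_simple cox_reflection_simple // cox_actN.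
Qed.

Lemma root_neq0 a : cox_roots a -> a <> 0.
Proof.
move=> [w [s ->]] /(congr1 (act w^-1%g)); rewrite cox_actK.
rewrite -{1}(scale0r (0 : V)) cox_actZ scale0r => /(congr1 (coeff s)).
by rewrite coeff_simple eqxx coeff0 => /eqP; rewrite oner_eq0.
Qed.

(** Either [w s] is longer than [w], or [w] is longer than [w s]; in the second case [w s] maps the
    simple root of [s] to the positive root [- a]. *)
Lemma root_sign a : cox_roots a -> nonneg a \/ nonneg (- a).
Proof.
move=> [w [s ->]]; case: (len_mul_simple HWS w s) => h.
  by left; exact: nonneg_act_simple.
right; rewrite -cox_actN -(cox_reflection_simple R invol) -cox_act_simple -cox_actM.
by apply: nonneg_act_simple; rewrite -mulgA invol mulg1.
Qed.

Lemma nonneg_oppF a : cox_roots a -> nonneg a -> nonneg (- a) -> False.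
Proof.
move=> ra pa na; apply: (root_neq0 ra); apply: freeg_ext => s; rewrite coeff0.
by apply/eqP; rewrite eq_le pa andbT -oppr_ge0 -coeffN na.
Qed.

Lemma inv_setP g a :
  inv_set g a <-> [/\ cox_roots a, nonneg a & nonneg (- act g^-1%g a)].
Proof.
split=> [[[ra pa]] [b [rb pb] h]|[ra pa na]].
  by split => //; rewrite -h opprK.
split; first by split.
exists (- act g^-1%g a); last by rewrite opprK.
by split => //; apply/root_opp/root_act.
Qed.

(** The reflection changes only the coefficient at [s]. If the image were negative, all other
    coefficients of [a] would vanish, and a root that is a nonnegative multiple of [al s] equals
    it. *)
Lemma nonneg_reflection s a : cox_roots a -> nonneg a -> a <> al s ->
  nonneg (act (val s) a).
Proof.
move=> ra pa as'; case: (root_sign (root_act (val s) ra)) => // na; exfalso.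
apply: as'; have a0 t : t != s -> coeff t a = 0.
  move=> ts; apply/eqP; rewrite eq_le pa andbT.
  have := na t; rewrite cox_act_simple /cox_reflection opprB coeffB coeffZ.
  by rewrite coeff_simple eq_sym (negbTE ts) mulr0 sub0r oppr_ge0.
have aE : a = coeff s a *: al s.
  apply: freeg_ext => t; rewrite coeffZ coeff_simple [s == t]eq_sym.
  by case: eqVneq => [->|/a0 ->]; rewrite ?mulr1 ?mulr0.
move: ra => [g [t at']]; rewrite aE.
by rewrite (@root_scale_simple g s t (coeff s a)) ?scale1r // -at'.
Qed.

Lemma inv_set_mul_simple_sub g s :
  inv_set (g * val s)%g `<=` inv_set g `|` [set act g (al s)].
Proof.
move=> a /inv_setP [ra pa na].
have rb := root_act g^-1%g ra.
case: (root_sign rb) => [pb|nb]; [right|left; exact/inv_setP].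
suff <- : act g^-1%g a = al s by rewrite cox_actKV.
apply: contrapT => /(nonneg_reflection rb pb) psb.
apply: (nonneg_oppF (root_act (val s) rb) psb).
by rewrite -cox_actM -{1}(val_invg invol s) -invgM.
Qed.

(** As [s] permutes the positive roots other than [al s], passing from [g] to [g s] can only affect
    the root [act g (al s)], here positive. *)
Lemma inv_set_mul_simple g s : len (g * val s)%g = (len g).+1 ->
  inv_set (g * val s)%g = inv_set g `|` [set act g (al s)].
Proof.
move=> gs; have pg := nonneg_act_simple gs.
apply/seteqP; split=> [|a []]; first exact: inv_set_mul_simple_sub.
  move=> /inv_setP [ra pa na]; apply/inv_setP; split => //.
  rewrite invgM val_invg // cox_actM -cox_actN.
  apply: nonneg_reflection => //; first exact/root_opp/root_act.
  move=> h; apply: (nonneg_oppF ra pa).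
  by rewrite -(cox_actKV g a) -cox_actN h.
move=> ->; apply/inv_setP; split=> //; first exact/root_act/root_simple.
rewrite invgM cox_actM cox_actK val_invg // cox_act_simple.
by rewrite cox_reflection_simple // opprK; exact: nonneg_simple.
Qed.

Lemma len_of_neg g s : nonneg (- act g (al s)) -> len g = (len (g * val s)%g).+1.
Proof.
move=> n; case: (len_mul_simple HWS g s) => // /nonneg_act_simple p; exfalso.
exact: nonneg_oppF (root_act g (root_simple s)) p n.
Qed.

Lemma inv_set1 : inv_set 1%g = set0 :> set V.
Proof.
apply/seteqP; split => // a /inv_setP [ra pa]; rewrite invg1 cox_act1.
exact: nonneg_oppF.
Qed.

Lemma inv_set_prefix g h : len (g * h)%g = (len g + len h)%N ->
  @inv_set R W S g `<=` inv_set (g * h)%g.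
Proof.
have [n] := ubnP (len h); elim: n h => // n IH h hn gh.
case: (pselect (h = 1%g)) => [->|h1]; first by rewrite mulg1.
have [s hs] := last_letter HWS h1.
have E : (g * h = g * (h * val s) * val s)%g.
  by rewrite -(mulgA g) -(mulgA h) invol mulg1.
have l1 := lenM HWS g (h * val s)%g.
have E1 : len (g * h)%g = (len (g * (h * val s))%g).+1.
  case: (len_mul_simple HWS (g * (h * val s))%g s); rewrite -E // => l2.
  by exfalso; move: l1 l2; rewrite gh hs; clear; lia.
apply: subset_trans (IH (h * val s)%g _ _) _.
- by move: hn; rewrite hs.
- by apply/eqP; rewrite -eqSS -E1 gh hs addnS.
by rewrite E inv_set_mul_simple -?E //; exact: subsetUl.
Qed.

(** Converse of [inv_set_prefix]: if [g = g' s] is reduced at [s], the root [act g' (al s)] lies in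
    [inv_set h], so [h^-1 g'] makes [al s] negative and [h^-1 g] is shorter by one. Inclusion of
    inversion sets is thus the prefix order. *)
Lemma inv_setS_len g h : @inv_set R W S g `<=` inv_set h ->
  (len g + len (g^-1 * h)%g)%N = len h.
Proof.
have [n] := ubnP (len g); elim: n g h => // n IH g h gn.
case: (pselect (g = 1%g)) => [->|g1]; first by rewrite invg1 mul1g len1.
have [s gs] := last_letter HWS g1.
set g' := (g * val s)%g in gs.
have gE : (g = g' * val s)%g by rewrite -mulgA invol mulg1.
rewrite [in inv_set _]gE inv_set_mul_simple -?gE // subUset => -[sub sub1].
have g'n : (len g' < n)%N by rewrite -ltnS -gs.
have := IH g' h g'n sub; rewrite gs.
have /inv_setP [_ _ n1] : inv_set h (act g' (al s)) by exact: sub1.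
have := @len_of_neg (h^-1 * g')%g s; rewrite cox_actM => /(_ n1).
rewrite -lenV // invgM invgK => e.
have -> : len (g^-1 * h)%g = len (h^-1 * g' * val s)%g.
  by rewrite -(mulgA _ g') -gE -[RHS]lenV // invgM invgK.
by rewrite e addnS addSn.
Qed.

End Roots.

(** * Directedness in the weak order, and limits of increasing sequences *)

Section WeakOrder.
Variables (R : realType) (W : groupType) (S : set W).
Hypothesis HWS : coxeter_system S.
Local Notation V := {freeg S / R}.
Local Notation al := (@simple_root R W S).
Local Notation wp := (@word_prod W S).
Local Notation len := (@len W S).
Local Notation act := (@cox_act R W S).
Local Notation inv_set := (@inv_set R W S).
Implicit Types (q r s t : S) (u : seq S) (e g h x y z : W) (a b : V).
Let invol := coxeter_invol HWS.

Definition inv_disjoint g h := forall a, inv_set g a -> ~ inv_set h a.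

Lemma coeff_word_act u q a : q \notin u -> coeff q (word_act u a) = coeff q a.
Proof.
elim: u => //= s u IH; rewrite inE negb_or => /andP [qs qu].
rewrite -/(word_act u a) /cox_reflection coeffB coeffZ coeff_simple eq_sym.
by rewrite (negbTE qs) mulr0 subr0 IH.
Qed.

Lemma freeg_two_terms r t a : r != t -> (forall q, q \notin [:: r; t] -> coeff q a = 0) ->
  a = coeff r a *: al r + coeff t a *: al t.
Proof.
move=> rt h; apply: freeg_ext => q; rewrite coeffD !coeffZ !coeff_simple.
case: (eqVneq q r) => [->|qr]; first by rewrite eq_sym (negbTE rt) mulr1 mulr0 addr0.
rewrite mulr0 add0r; case: (eqVneq q t) => [->|qt]; first by rewrite mulr1.
by rewrite mulr0 h // !inE negb_or qr qt.
Qed.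

Lemma inv_set_factor g h : (len g + len (g^-1 * h)%g <= len h)%N ->
  inv_set g `<=` inv_set h.
Proof.
move=> le; rewrite -(mulVKg g h); apply: (@inv_set_prefix R W S HWS g (g^-1 * h)%g).
apply/eqP; by rewrite eqn_leq lenM //= mulVKg.
Qed.

(** [r] is the first letter of a reduced word of [z^-1 x]. *)
Lemma inv_set_first_letter z x : inv_set z `<=` inv_set x -> z <> x ->
  exists2 r : S, len (z * val r)%g = (len z).+1 & inv_set (z * val r)%g `<=` inv_set x.
Proof.
move=> /(inv_setS_len HWS); set k := (z^-1 * x)%g => zx neq.
have xE : x = (z * k)%g by rewrite mulVKg.
have [|r kr] := first_letter HWS (g := k).
  by move=> k1; apply: neq; rewrite xE k1 mulg1.
have xr : x = (z * val r * (val r * k))%g by rewrite -mulgA mul_simpleKg.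
have zr : len (z * val r)%g = (len z).+1.
  case: (len_mul_simple HWS z r) => // zr; exfalso.
  by have := lenM HWS (z * val r)%g (val r * k)%g; rewrite -xr -zx zr kr; clear; lia.
exists r => //; apply: inv_set_factor; rewrite {1}xr mulKg zr -zx kr.
by clear; lia.
Qed.

(* The element is [z p] with [p] a longest prefix of [z^-1 e] among the words in [r]
   and [t].  Roots in [inv_set (z p)] but not in [inv_set z] are nonnegative
   combinations of the images under [z] of the two simple roots, which [g^-1] keeps
   positive. *)
Lemma dihedral_join z e g r t : r != t ->
  (forall j : S, j \in [:: r; t] -> [/\ len (z * val j)%g = (len z).+1,
    inv_set (z * val j)%g `<=` inv_set e & inv_disjoint (z * val j)%g g]) ->
  exists m, [/\ forall j : S, j \in [:: r; t] -> inv_set (z * val j)%g `<=` inv_set m,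
    inv_set m `<=` inv_set e & inv_disjoint m g].
Proof.
move=> rt hyp.
have zj (j : S) : j \in [:: r; t] -> inv_set z `<=` inv_set (z * val j)%g.
  by move=> /hyp [zj _ _]; rewrite inv_set_mul_simple //; exact: subsetUl.
have pos (j : S) : j \in [:: r; t] -> nonneg (act z (al j)).
  by move=> /hyp [zj' _ _]; exact: nonneg_act_simple.
have jin (j : S) : j \in [:: r; t] -> inv_set (z * val j)%g (act z (al j)).
  by move=> /hyp [zj' _ _]; rewrite inv_set_mul_simple //; right.
have rin : r \in [:: r; t] by rewrite mem_head.
have tin : t \in [:: r; t] by rewrite !inE eqxx orbT.
have ze : inv_set z `<=` inv_set e.
  by apply: subset_trans (zj _ rin) _; have [] := hyp _ rin.
have := inv_setS_len HWS ze; set h := (z^-1 * e)%g => zh.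
pose P k := `[< exists u, [/\ all (mem [:: r; t]) u, k = len (wp u) &
  (len (wp u) + len ((wp u)^-1 * h)%g)%N = len h] >].
have P0 : P 0%N.
  by apply/asboolP; exists [::]; rewrite word_prod_nil len1 // invg1 mul1g.
have Pb k : P k -> (k <= len h)%N.
  by move=> /asboolP [u [_ -> <-]]; exact: leq_addr.
case: (ex_maxnP (ex_intro P _ P0) Pb) => k /asboolP [u [ujt -> uh]] umax.
set p := wp u in uh umax; set h' := (p^-1 * h)%g in uh.
have hE : h = (p * h')%g by rewrite mulVKg.
(* By maximality of [p], neither letter can be split off the front of [h']. *)
have h'pos (j : S) : j \in [:: r; t] -> nonneg (act h'^-1%g (al j)).
  move=> jr; apply: nonneg_act_simple => //.
  case: (len_mul_simple HWS h'^-1%g j) => // h'j; exfalso.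
  have e1 : len h' = (len (val j * h')%g).+1.
    by rewrite -(lenV HWS h') h'j -(lenV HWS (val j * h')%g) (invgM (val j) h') val_invg.
  have e2 : h = (p * val j * (val j * h'))%g by rewrite -mulgA mul_simpleKg.
  have e3 : len (p * val j)%g = (len p).+1.
    case: (len_mul_simple HWS p j) => // pj; exfalso.
    have := lenM HWS (p * val j)%g (val j * h')%g; rewrite -e2 -uh e1 pj; clear; lia.
  suff /umax : P (len p).+1 by rewrite ltnn.
  apply/asboolP; exists (rcons u j).
  rewrite -[in wp _]cats1 word_prod_cat word_prod1 -/p e3; split => //.
    by rewrite all_rcons ujt andbT.
  have -> : ((p * val j)^-1 * h = val j * h')%g by rewrite e2 mulKg.
  by rewrite -uh e1 addSnnS.
have lzp : len (z * p)%g = (len z + len p)%N.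
  apply/eqP; rewrite eqn_leq lenM //=; have := lenM HWS (z * p)%g h'.
  by rewrite -mulgA -hE mulVKg -zh -uh; clear; lia.
have zzp : inv_set z `<=` inv_set (z * p)%g by exact: inv_set_prefix.
have zpe : inv_set (z * p)%g `<=` inv_set e.
  by apply: inv_set_factor; rewrite invgM -mulgA -/h -/h' lzp -zh -uh addnA.
have out q a : q \notin [:: r; t] -> coeff q (act p^-1%g a) = coeff q a.
  move=> qrt; rewrite -word_prod_rev // cox_act_word // coeff_word_act //.
  by rewrite mem_rev; apply: contra qrt => /(allP ujt).
exists (z * p)%g; split=> //.
  move=> j jr; have [zj1 sub dis] := hyp _ jr.
  rewrite (inv_set_mul_simple R HWS zj1) subUset; split=> // _ ->.
  have rj : cox_roots (act z (al j)) by exact/root_act/root_simple.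
  apply/(inv_setP HWS); split=> //; first exact: pos.
  rewrite invgM cox_actM // cox_actK //.
  have rpj : cox_roots (act p^-1%g (al j)) by exact/root_act/root_simple.
  (* Were [act p^-1 (al j)] positive, it would be a nonnegative combination of [al r] and [al t],
     kept positive by [h'^-1]; but [act z (al j)] is an inversion of [e]. *)
  case: (root_sign HWS rpj) => // npj; exfalso.
  have /(inv_setP HWS) [_ _ ne] := sub _ (jin _ jr).
  apply: (nonneg_oppF HWS (root_act HWS e^-1%g rj)) ne.
  have -> : act e^-1%g (act z (al j)) = act h'^-1%g (act p^-1%g (al j)).
    by rewrite -!cox_actM // -invgM -hE /h invgM invgK.
  rewrite (@freeg_two_terms r t (act p^-1%g (al j))) //.
    by rewrite cox_actD // !cox_actZ //; apply: nonneg_comb => //; exact: h'pos.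
  move=> q qrt; rewrite out // coeff_simple.
  by case: eqVneq => // jq; move: qrt; rewrite -jq jr.
move=> c /(inv_setP HWS) [rc pc]; rewrite invgM cox_actM // => nc cg.
have rb : cox_roots (act z^-1%g c) by exact: root_act.
case: (root_sign HWS rb) => [pb|nb]; last first.
  have [_ _ dis] := hyp _ rin; apply: (dis c) => //.
  by apply: (zj _ rin); apply/(inv_setP HWS).
(* [p^-1] makes this positive root negative without touching the coefficients outside [r] and [t],
   which therefore vanish. *)
have bE : act z^-1%g c = coeff r (act z^-1%g c) *: al r + coeff t (act z^-1%g c) *: al t.
  apply: freeg_two_terms => // q qrt; apply/eqP; rewrite eq_le pb andbT.
  by have := nc q; rewrite coeffN out // oppr_ge0.
have gpos (j : S) : j \in [:: r; t] -> nonneg (act g^-1%g (act z (al j))).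
  move=> jr; have [_ _ dis] := hyp _ jr.
  have rj : cox_roots (act z (al j)) by exact/root_act/root_simple.
  case: (root_sign HWS (root_act HWS g^-1%g rj)) => // ng; exfalso.
  by apply: (dis _ (jin _ jr)); apply/(inv_setP HWS); split => //; exact: pos.
have /(inv_setP HWS) [_ _ ng] := cg.
apply: (nonneg_oppF HWS (root_act HWS g^-1%g rc)) ng.
rewrite -(cox_actKV HWS z c) bE !(cox_actD HWS) !(cox_actZ HWS).
by apply: nonneg_comb => //; exact: gpos.
Qed.

Lemma inv_disjoint_directed e g x y : inv_set x `<=` inv_set e -> inv_set y `<=` inv_set e ->
  inv_disjoint x g -> inv_disjoint y g ->
  exists m, [/\ inv_set x `<=` inv_set m, inv_set y `<=` inv_set m,
    inv_set m `<=` inv_set e & inv_disjoint m g].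
Proof.
move=> xe ye xg yg.
(* Induction on a strict bound [n] for [len e - len z]; at [n = 0] the element [z] would be longer
   than [e]. *)
suff claim n z : (len e < len z + n)%N -> forall x y,
    inv_set z `<=` inv_set x -> inv_set z `<=` inv_set y ->
    inv_set x `<=` inv_set e -> inv_set y `<=` inv_set e ->
    inv_disjoint x g -> inv_disjoint y g ->
    exists m, [/\ inv_set x `<=` inv_set m, inv_set y `<=` inv_set m,
      inv_set m `<=` inv_set e & inv_disjoint m g].
  have z0 k : inv_set 1%g `<=` inv_set k by rewrite inv_set1 //; exact: sub0set.
  exact: (claim (len e).+1 1%g (leq_addl _ _) x y (z0 x) (z0 y) xe ye xg yg).
move: n z {x y xe ye xg yg}; elim=> [|n IH] z zn x y zx zy xe ye xg yg.
  have := inv_setS_len HWS (subset_trans zx xe); move: zn; rewrite addn0.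
  by move=> h1 h2; move: h1; rewrite -h2 ltnNge leq_addr.
case: (pselect (z = x)) => [<-|zx']; first by exists y; split => // a.
case: (pselect (z = y)) => [<-|zy']; first by exists x; split => // a.
have [r zr rx] := inv_set_first_letter zx zx'.
have [t zt ty] := inv_set_first_letter zy zy'.
have zrn : (len e < len (z * val r)%g + n)%N by rewrite zr addSnnS.
have ztn : (len e < len (z * val t)%g + n)%N by rewrite zt addSnnS.
case: (eqVneq r t) => [rt|rt]; first by apply: (IH _ zrn) => //; rewrite rt.
have [j|m [jm me mg]] := @dihedral_join z e g r t rt.
  rewrite !inE => /orP [] /eqP ->.
    by split => //; [exact: subset_trans xe | move=> a /rx /xg].
  by split => //; [exact: subset_trans ye | move=> a /ty /yg].
have rm : inv_set (z * val r)%g `<=` inv_set m by apply: jm; rewrite mem_head.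
have tm : inv_set (z * val t)%g `<=` inv_set m by apply: jm; rewrite !inE eqxx orbT.
(* [x] and [m] are joined over [z r], then the result and [y] over [z t]. *)
have [m1 [xm1 mm1 m1e m1g]] := IH _ zrn x m rx rm xe me xg mg.
have [m2 [ym2 mm2 m2e m2g]] := IH _ ztn y m1 ty (subset_trans tm mm1) ye m1e yg m1g.
by exists m2; split => //; exact: subset_trans mm2.
Qed.

(** Lengths are bounded by [len e], so a longest candidate [m] exists. Directedness puts [m] and any
    [x] below a candidate that is no longer than [m], hence equal to it. *)
Lemma inv_disjoint_max e g : exists m, [/\ inv_set m `<=` inv_set e, inv_disjoint m g &
  forall x, inv_set x `<=` inv_set e -> inv_disjoint x g -> inv_set x `<=` inv_set m].
Proof.
pose P k := `[< exists x, [/\ k = len x, inv_set x `<=` inv_set e & inv_disjoint x g] >].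
have P0 : P 0%N.
  apply/asboolP; exists 1%g; rewrite len1 // inv_set1 //; split => //.
  by move=> a; rewrite inv_set1.
have Pb k : P k -> (k <= len e)%N.
  by move=> /asboolP [x [-> /(inv_setS_len HWS) <- _]]; exact: leq_addr.
case: (ex_maxnP (ex_intro P _ P0) Pb) => k /asboolP [m [-> me mg]] mmax.
exists m; split => // x xe xg.
have [z [mz xz ze zg]] := inv_disjoint_directed me xe mg xg.
suff -> : m = z by [].
have zm : (len z <= len m)%N by apply: mmax; apply/asboolP; exists z.
have := inv_setS_len HWS mz => h; rewrite -[RHS](mulVKg m).
rewrite (@len_eq0 _ _ HWS (m^-1 * z)%g) ?mulg1 //.
by move: h zm; clear; lia.
Qed.

Definition increasing_inv (E : nat -> W) := forall n, inv_set (E n) `<=` inv_set (E n.+1).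

Lemma increasing_inv_le E i j : increasing_inv E -> (i <= j)%N ->
  inv_set (E i) `<=` inv_set (E j).
Proof.
move=> inc /subnKC <-; elim: (j - i)%N => [|k IH]; first by rewrite addn0.
by rewrite addnS; apply: subset_trans IH _.
Qed.

(** Inversion sets are finite: each letter of a reduced word adds one root, which appears at some
    stage of the increasing union. *)
Lemma inv_set_compact E g : increasing_inv E ->
  inv_set g `<=` \bigcup_n inv_set (E n) -> exists n, inv_set g `<=` inv_set (E n).
Proof.
move=> inc; have [n] := ubnP (len g); elim: n g => // n IH g gn.
case: (pselect (g = 1%g)) => [->|g1]; first by exists 0%N; rewrite inv_set1.
have [s gs] := last_letter HWS g1.
rewrite -(mulg_simpleK HWS g s) inv_set_mul_simple ?mulg_simpleK // subUset => -[sub sub1].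
have [|i gi] := IH (g * val s)%g _ sub; first by rewrite -ltnS -gs.
have [j _ gj] := sub1 _ erefl.
exists (maxn i j); rewrite subUset; split.
  exact: subset_trans gi (increasing_inv_le inc (leq_maxl _ _)).
by move=> _ ->; apply: (increasing_inv_le inc (leq_maxr i j)).
Qed.

Lemma reduced_word_prefix u v : reduced_word (u ++ v) ->
  reduced_word u /\ inv_set (wp u) `<=` inv_set (wp (u ++ v)).
Proof.
move=> /(reduced_wordE HWS); rewrite word_prod_cat size_cat => uv.
have h1 := lenM HWS (wp u) (wp v); have h2 := len_word HWS u.
have h3 := len_word HWS v; split.
  by apply/(reduced_wordE HWS); move: uv h1 h2 h3; clear; lia.
by apply: inv_set_prefix => //; move: uv h1 h2 h3; clear; lia.
Qed.

Lemma mkseq_prefix (T : Type) (f : nat -> T) i n :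
  mkseq f (i + n) = mkseq f i ++ mkseq (fun k => f (i + k)%N) n.
Proof. by rewrite /mkseq iotaD map_cat add0n -{2}(addn0 i) iotaDl -map_comp. Qed.

Lemma Phi_increasing_union (c : Wbar R S) : exists2 E : nat -> W,
  increasing_inv E & Phi c = \bigcup_n inv_set (E n).
Proof.
case: c => [c|w]; last first.
  exists (fun=> w); first by move=> n a.
  by apply/seteqP; split => [a aw|a [_ _ //]]; exists 0%N.
pose f := val (repr c); have /asboolP fred := valP (repr c).
exists (fun n => wp (mkseq f n)).
  move=> n a; have := fred n.+1 isT; rewrite -addn1 mkseq_prefix.
  by move=> /reduced_word_prefix [_]; apply.
apply/seteqP; split=> [a [i _ ai]|a [i _ ai]]; first by exists i.
(* [inf_inv_set] starts at index 1; the extra index 0 contributes the empty set. *)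
case: i ai => [|i] ai; last by exists i.+1.
by move: ai; rewrite /mkseq /= word_prod_nil inv_set1.
Qed.

(** If the lengths are bounded, the sequence is constant from a longest term on. Otherwise reduced
    words of the successive quotients concatenate to an infinite reduced word. *)
Lemma increasing_union_Phi E : increasing_inv E ->
  exists c : Wbar R S, Phi c = \bigcup_n inv_set (E n).
Proof.
move=> inc.
have lenE i j : (i <= j)%N -> (len (E i) + len ((E i)^-1 * E j)%g)%N = len (E j).
  by move=> ij; apply: (inv_setS_len HWS); exact: increasing_inv_le.
case: (pselect (exists N, forall n, (len (E n) <= N)%N)) => [[N bN]|unb].
  pose P k := `[< exists n, k = len (E n) >].
  have P0 : P (len (E 0%N)) by apply/asboolP; exists 0%N.
  have Pb k : P k -> (k <= N)%N by move=> /asboolP [n ->].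
  case: (ex_maxnP (ex_intro P _ P0) Pb) => k /asboolP [n ->] nmax.
  exists (inr (E n)); apply/seteqP; split=> [a an|a [j _ aj]]; first by exists n.
  have /(increasing_inv_le inc) aj' := leq_maxr n j.
  suff -> : E n = E (maxn n j) by exact: aj'.
  have h := lenE n (maxn n j) (leq_maxl _ _).
  have hm : (len (E (maxn n j)) <= len (E n))%N.
    by apply: nmax; apply/asboolP; exists (maxn n j).
  rewrite -[RHS](mulVKg (E n)) (@len_eq0 _ _ HWS ((E n)^-1 * _)%g) ?mulg1 //.
  by move: h hm; clear; lia.
pose c := fix c n := if n is n'.+1 then c n' ++ red_word S ((E n')^-1 * E n'.+1)%g
                     else red_word S (E 0%N).
have cE n : wp (c n) = E n.
  elim: n => [|n IH] /=; first by rewrite red_wordK.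
  by rewrite word_prod_cat IH red_wordK // mulVKg.
have cred n : reduced_word (c n).
  apply/(reduced_wordE HWS); rewrite cE; elim: n => [//|n IH].
  by rewrite /= size_cat -IH -[in LHS](lenE n).
have csize n : size (c n) = len (E n) by rewrite -cE; apply/esym/(reduced_wordE HWS).
have cpre i k : exists v, c (i + k)%N = c i ++ v.
  elim: k => [|k [v IH]]; first by exists [::]; rewrite addn0 cats0.
  by rewrite addnS /= IH; exists (v ++ red_word S ((E (i + k)%N)^-1 * E (i + k).+1)%g);
    rewrite catA.
have cbig k : exists n, (k < size (c n))%N.
  apply: contrapT => h; apply: unb; exists k => n; rewrite leqNgt; apply/negP => kn.
  by apply: h; exists n; rewrite csize.
(* A default letter for [nth], available since some [c n] is nonempty. *)
have [s0 _] : exists s : S, True.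
  by have [n] := cbig 0%N; case: (c n) => // s _ _; exists s.
have [N hN] := choice cbig.
(* [c (N k)] has more than [k] letters; any other [c n] that long gives the same letter, as the
   words [c n] are prefixes of one another. *)
pose f k := nth s0 (c (N k)) k.
have nthc i j k : (k < size (c i))%N -> (k < size (c j))%N ->
    nth s0 (c i) k = nth s0 (c j) k.
  wlog ij : i j / (i <= j)%N.
    by move=> h ki kj; case: (leqP i j) => [/h|/ltnW /h h']; [apply|rewrite h'].
  move=> ki _; have [v] := cpre i (j - i)%N; rewrite subnKC // => ->.
  by rewrite nth_cat ki.
have fE k n : (k <= size (c n))%N -> mkseq f k = take k (c n).
  move=> kn; apply: (@eq_from_nth _ s0); first by rewrite size_mkseq size_takel.
  move=> i; rewrite size_mkseq => ik; rewrite nth_mkseq // nth_take //.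
  by apply: nthc => //; exact: leq_trans kn.
have ftake k : exists n, mkseq f k = take k (c n).
  by exists (N k); apply: fE; apply: ltnW.
have fred : `[< infinite_reduced f >].
  apply/asboolP => k _; have [n ->] := ftake k.
  by have := cred n; rewrite -{1}(cat_take_drop k (c n)) => /reduced_word_prefix [].
exists (inl (\pi_(inf_words R S)%qT (exist _ f fred : inf_red_expr S))).
rewrite /Phi inf_word_inv_set_pi /inf_inv_set.
apply/seteqP; split=> [a [k _ /=]|a [n _ an]].
  have [n ->] := ftake k => ak; exists n => //; rewrite -cE.
  have := cred n; rewrite -{1 2}(cat_take_drop k (c n)).
  by move=> /reduced_word_prefix [_]; apply.
exists (size (c n)) => /=; last by rewrite (fE _ n) // take_size cE.
(* Prefixes in [inf_inv_set] are nonempty; an empty [c n] would have no inversion [a]. *)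
rewrite lt0n; apply/eqP => /size0nil c0; move: an.
by rewrite -cE c0 word_prod_nil inv_set1.
Qed.

End WeakOrder.

Theorem theorem2p11 (R : realType) (W : groupType) (S : set W)
    (HWS : coxeter_system S) (Winf : infinite_set [set: W])
    (A : set (Wbar R S)) (w : Wbar R S) (Hw : is_join A w)
    (v : Wbar R S) (Hv : forall a : Wbar R S, A a -> weak_orth a v) :
  weak_orth w v.
Proof.
have [E Einc wE] := Phi_increasing_union HWS w.
have [F Finc vF] := Phi_increasing_union HWS v.
apply/seteqP; split => // a [aw]; rewrite vF => -[i _ ai].
(* [F i] is the element [g] of the outline. *)
have [M hM] := choice (fun n => inv_disjoint_max R HWS (E n) (F i)).
have Minc : increasing_inv R S M.
  move=> n; have [Mn Md _] := hM n; have [_ _ Mmax] := hM n.+1.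
  by apply: Mmax => //; apply: subset_trans Mn (Einc n).
have [u uM] := increasing_union_Phi HWS Minc.
have uub b : A b -> weak_le b u.
  move=> Ab; have [G Ginc bG] := Phi_increasing_union HWS b.
  rewrite /weak_le bG uM => c [j _ cj].
  have Gb : inv_set (G j) `<=` Phi b by rewrite bG => d dj; exists j.
  (* Since [b] lies below [w], compactness puts [G j] below a single [E n]; being orthogonal to
     [F i], it is then below [M n]. *)
  have [n Gn] : exists n, @inv_set R W S (G j) `<=` inv_set (E n).
    apply: inv_set_compact => //; rewrite -wE.
    by apply: subset_trans Gb _; apply: Hw.1.
  exists n => //; have [_ _ Mmax] := hM n; apply: (Mmax (G j)) => // d /Gb db dF.
  suff : (Phi b `&` Phi v) d by rewrite (Hv b Ab).
  by split => //; rewrite vF; exists i.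
have : Phi u a by apply: (Hw.2 u uub).
by rewrite uM => -[n _ an]; have [_ Md _] := hM n; case: (Md a an ai).
Qed.
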